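(* The SIC property does not determine the projective simulability threshold in dimension three: there exist two SIC-POVMs $\mathbf{E}$ and $\mathbf{E}'$ on $\mathbb{C}^3$ with $v^*(\mathbf{E})\neq v^*(\mathbf{E}')$.
   Context: An $n$-outcome POVM on $\mathbb{C}^d$ is a tuple $\{E_a\}_{a=1}^n$ of positive semidefinite $d\times d$ complex matrices with $\sum_a E_a=\mathbb{1}$. An $n$-outcome projective measurement is a POVM all of whose elements are orthogonal projections (some possibly zero). A POVM $\{E_a\}_{a=1}^n$ is projectively simulable if there are a finite probability distribution $\{q_\lambda\}_\lambda$ and $n$-outcome projective measurements $\{P_{a|\lambda}\}_{a=1}^n$ on $\mathbb{C}^d$ with $E_a=\sum_\lambda q_\lambda P_{a|\lambda}$ for all $a$. For $v\in[0,1]$ the depolarising map is $\Phi_v(X)=vX+\frac{1-v}{d}\operatorname{tr}(X)\mathbb{1}$. The projective simulability threshold of $\mathbf{E}=\{E_a\}_a$ is $v^*(\mathbf{E})=\max\{v\in[0,1] : \{\Phi_v(E_a)\}_a \text{ is projectively simulable}\}$. A SIC-POVM on $\mathbb{C}^d$ is a $d^2$-outcome POVM of the form $E_a=\frac1d|\psi_a\rangle\langle\psi_a|$ with unit vectors $\psi_a$ satisfying $|\langle\psi_a|\psi_b\rangle|^2=\frac1{d+1}$ for all $a\ne b$. *)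

(* Defs.v *)
From HB Require Import structures.
From mathcomp Require Import all_boot all_order all_algebra.
From mathcomp Require Import complex.
From mathcomp Require Import classical_sets reals.

Set Implicit Arguments.
Unset Strict Implicit.
Unset Printing Implicit Defensive.

Import Order.TTheory GRing.Theory Num.Theory.
Local Open Scope ring_scope.
Local Open Scope complex_scope.
Local Open Scope sesquilinear_scope.
Local Open Scope classical_set_scope.

(* The order on R[i] is partial: 0 <= z says that z is real and nonnegative. *)
Definition psdmx (R : realType) (d : nat) (A : 'M[R[i]]_d) : Prop :=
  A \is hermsymmx /\ forall x : 'cV[R[i]]_d, 0 <= (x ^t* *m A *m x) 0 0.

Definition povm (R : realType) (d n : nat) (E : 'I_n -> 'M[R[i]]_d) : Prop :=
  (forall a, psdmx (E a)) /\ \sum_(a < n) E a = 1%:M.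

Definition orthogonal_projection (R : realType) (d : nat) (P : 'M[R[i]]_d) :
    Prop :=
  P \is hermsymmx /\ P *m P = P.

Definition projective_measurement (R : realType) (d n : nat)
    (P : 'I_n -> 'M[R[i]]_d) : Prop :=
  povm P /\ forall a, orthogonal_projection (P a).

Definition projectively_simulable (R : realType) (d n : nat)
    (E : 'I_n -> 'M[R[i]]_d) : Prop :=
  exists (m : nat) (q : 'I_m -> R) (P : 'I_m -> 'I_n -> 'M[R[i]]_d),
    [/\ forall l, 0 <= q l,
        \sum_(l < m) q l = 1,
        forall l, projective_measurement (P l)
      & forall a, E a = \sum_(l < m) (q l)%:C *: P l a].

Definition depolarise (R : realType) (d : nat) (v : R) (X : 'M[R[i]]_d) :
    'M[R[i]]_d :=
  v%:C *: X + (((1 - v) / d%:R)%:C * \tr X) *: 1%:M.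

Definition simulable_visibilities (R : realType) (d n : nat)
    (E : 'I_n -> 'M[R[i]]_d) : set R :=
  [set v | 0 <= v <= 1 /\
           projectively_simulable (fun a => depolarise v (E a))].

(* The threshold is a maximum, so it is a relation [v^*(E) = v] that includes
   attainment; such a v is unique when it exists. *)
Definition is_simulability_threshold (R : realType) (d n : nat)
    (E : 'I_n -> 'M[R[i]]_d) (v : R) : Prop :=
  simulable_visibilities E v /\ ubound (simulable_visibilities E) v.

(* For column vectors, psi *m psi ^t* is the ket-bra |psi><psi| and
   (phi ^t* *m psi) 0 0 is the inner product <phi|psi>. *)
Definition sic_povm (R : realType) (d : nat)
    (E : 'I_(d ^ 2)%N -> 'M[R[i]]_d) : Prop :=
  povm E /\
  exists psi : 'I_(d ^ 2)%N -> 'cV[R[i]]_d,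
    [/\ forall a, (psi a ^t* *m psi a) 0 0 = 1,
        forall a b, a != b ->
          `|(psi a ^t* *m psi b) 0 0| ^+ 2 = (d.+1%:R)^-1
      & forall a, E a = (d%:R)^-1 *: (psi a *m psi a ^t*)].

(* Main.v *)
(* Every simulation is a mixture of measurements in orthonormal bases whose
   vectors carry outcome labels, so the functional
     sum_a <psi_a|P_a|psi_a>
   bounds the visibility v through 1 + 2 v <= max, and for three distinct labels
   its maximum depends only on the phase of the triple product
   <psi_a|psi_b><psi_b|psi_c><psi_c|psi_a>.  For the Hesse SIC, the
   Weyl-Heisenberg orbit of (0,1,-1)/sqrt 2, every triple product has phase
   +-pi/3 or pi, and the maximum is below 13/5, so v <= 4/5.  The orbit of
   (0,1,1)/sqrt 2 also has triples of phase 0; mixing bases adapted to these with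
   bases adapted to triples of phase +-pi/3, and averaging over a monomial group,
   gives an explicit simulation over Q(omega) at v = 169/210 > 4/5.  The maxima
   exist because the mixtures can be taken of bounded length (Caratheodory), so
   they pass to the limit along an ultrafilter. *)
Require Import Defs.
From Stdlib Require Import ZArith.
From mathcomp Require Import all_boot all_order all_algebra.
From mathcomp Require Import ring lra ssrZ.
From mathcomp Require Import boolp classical_sets functions.
From mathcomp Require Import complex reals filter topology normedtype sequences.

Set Implicit Arguments.
Unset Strict Implicit.
Unset Printing Implicit Defensive.

Import Order.TTheory GRing.Theory Num.Theory.
Import numFieldNormedType.Exports.
Delimit Scope Z_scope with ZZ.
Local Open Scope ring_scope.
Local Open Scope sesquilinear_scope.

(** * Three orthonormal vectors against three columns of given Gram matrix *)

Section HermitianForm.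
Variable C : numClosedFieldType.
Implicit Types (x y z p q r d B g rho k t : C).

Lemma sum3 (V : nmodType) (F : 'I_3 -> V) :
  \sum_i F i = F ord0 + F (lift ord0 ord0) + F (lift ord0 (lift ord0 ord0)).
Proof. by rewrite !big_ord_recl big_ord0 addr0 addrA. Qed.

Definition herm_form d p q r x y z : C :=
  d * (x * x^* + y * y^* + z * z^*) +
  (p * x^* * y + p^* * x * y^*) + (q * y^* * z + q^* * y * z^*) +
  (r * z^* * x + r^* * z * x^*).

(** The difference of the two sides is the Hermitian form with diagonal [d - 1, d, d] and
    off-diagonal entries [p, q, r]. By Sylvester's criterion it suffices to control [d], the minor
    [s] in the coordinates [y, z], and the determinant [D]; eliminating [z] and then [y] leaves a
    sum of squares. *)
Lemma normsq_le_herm_form d k t p q r x y z :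
  0 < d -> 0 < d ^+ 2 - k -> p * p^* = k -> q * q^* = k -> r * r^* = k ->
  p * q * r + p^* * q^* * r^* = 2%:R * t ->
  0 <= (d - 1) * d ^+ 2 + 2%:R * t - (d - 1) * k - 2%:R * d * k ->
  x * x^* <= herm_form d p q r x y z.
Proof.
move=> d0 s0 pk qk rk pqr det0; rewrite -subr_ge0.
set s := d ^+ 2 - k in s0; set D := (X in 0 <= X) in det0.
set F := _ - _.
have dR : d^* = d by apply/CrealP/gtr0_real.
have sR : s^* = s by apply/CrealP/gtr0_real.
(* [s], [e], [u], [U] are the entries of [d] times the Schur complement left after eliminating [z];
   its determinant is [d * D]. *)
set e := (d - 1) * d - k.
pose u := d * p - r^* * q^*; pose U := d * p^* - r * q.
have uU : s * e - u * U = d * D.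
  have -> : u * U = d ^+ 2 * (p * p^*) - d * (p * q * r + p^* * q^* * r^*)
                  + (r * r^*) * (q * q^*) by rewrite /u /U; ring.
  by rewrite pk qk rk pqr /s /e /D; ring.
have dF : d * F = (d * z + q^* * y + r * x) * (d * z + q^* * y + r * x)^* +
    (s * (y * y^*) + e * (x * x^*) + u * x^* * y + U * x * y^*).
  rewrite !rmorphD !rmorphM /= conjCK dR /s /e -{1}qk -rk /F /herm_form /u /U; ring.
have sdF : s * (d * F) = s * ((d * z + q^* * y + r * x) * (d * z + q^* * y + r * x)^*) +
    ((s * y + U * x) * (s * y + U * x)^* + d * D * (x * x^*)).
  rewrite dF -uU mulrDr; congr (_ + _).
  have -> : (s * y + U * x)^* = s * y^* + u * x^*.
    rewrite rmorphD !rmorphM /= sR; congr (_ + _ * _).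
    by rewrite /U /u rmorphB !rmorphM /= conjCK dR.
  by rewrite /s /e; ring.
rewrite -(pmulr_rge0 _ d0) -(pmulr_rge0 _ s0) sdF.
apply: addr_ge0; first by apply: mulr_ge0; [exact: ltW|exact: mul_conjC_ge0].
apply: addr_ge0; first exact: mul_conjC_ge0.
by apply: mulr_ge0; [apply: mulr_ge0 => //; exact: ltW|exact: mul_conjC_ge0].
Qed.

(* The bound is the trace of L G for L = al + be G + g G^2, where
   d = al + be + 3 g / 2, B = be + 2 g, and rho is the real part of the triple
   product.  The sharp L is a multiple of G^(-1/2) (the square-root
   measurement), which a quadratic polynomial in G can approximate. *)
Lemma gram_trace_bound (A : 'M[C]_3) d B g rho :
  let G := A^t* *m A in
  let a := G ord0 (lift ord0 ord0) in
  let b := G (lift ord0 ord0) (lift ord0 (lift ord0 ord0)) in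
  let c := G (lift ord0 (lift ord0 ord0)) ord0 in
  let k := B ^+ 2 / 4%:R + g ^+ 2 / 16%:R + 2%:R * B * g * rho in
  let t := B ^+ 3 * rho + 3%:R * B ^+ 2 * g / 16%:R
           + 3%:R * B * g ^+ 2 * rho / 4%:R
           + g ^+ 3 * (2%:R * rho ^+ 2 - 64%:R^-1) in
  (forall j, G j j = 1) ->
  a * a^* = 4%:R^-1 -> b * b^* = 4%:R^-1 -> c * c^* = 4%:R^-1 ->
  a * b * c + (a * b * c)^* = 2%:R * rho ->
  B^* = B -> g^* = g -> 0 < d -> 0 < d ^+ 2 - k ->
  0 <= (d - 1) * d ^+ 2 + 2%:R * t - (d - 1) * k - 2%:R * d * k ->
  \sum_i A i i * (A i i)^* <= 3%:R * d + 3%:R / 2%:R * B + 6%:R * g * rho.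
Proof.
move=> G a b c k t G1 ha hb hc hz BR gR d0 s0 det0.
(* The entries of [L] at positions (1,0), (2,1), (0,2). As all overlaps have squared modulus 1/4,
   these have squared modulus [k], and their product has real part [t]. *)
pose p := B * a^* + g * (b * c); pose q := B * b^* + g * (c * a).
pose r := B * c^* + g * (a * b).
have pE : p^* = B * a + g * (b^* * c^*).
  by rewrite rmorphD !rmorphM /= conjCK BR gR.
have qE : q^* = B * b + g * (c^* * a^*).
  by rewrite rmorphD !rmorphM /= conjCK BR gR.
have rE : r^* = B * c + g * (a^* * b^*).
  by rewrite rmorphD !rmorphM /= conjCK BR gR.
have hz2 : a * b * c + a^* * b^* * c^* = 2%:R * rho by rewrite -hz !rmorphM.
have pk : p * p^* = k.
  transitivity (B ^+ 2 * (a * a^*) + g ^+ 2 * ((b * b^*) * (c * c^*)) +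
     B * g * (a * b * c + a^* * b^* * c^*)); first by rewrite pE /p; ring.
  by rewrite ha hb hc hz2 /k; field.
have qk : q * q^* = k.
  transitivity (B ^+ 2 * (b * b^*) + g ^+ 2 * ((c * c^*) * (a * a^*)) +
     B * g * (a * b * c + a^* * b^* * c^*)); first by rewrite qE /q; ring.
  by rewrite ha hb hc hz2 /k; field.
have rk : r * r^* = k.
  transitivity (B ^+ 2 * (c * c^*) + g ^+ 2 * ((a * a^*) * (b * b^*)) +
     B * g * (a * b * c + a^* * b^* * c^*)); first by rewrite rE /r; ring.
  by rewrite ha hb hc hz2 /k; field.
have pqr : p * q * r + p^* * q^* * r^* = 2%:R * t.
  pose sa := a * a^*; pose sb := b * b^*; pose sc := c * c^*.
  transitivity (B ^+ 3 * (a * b * c + a^* * b^* * c^*) +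
     2%:R * B ^+ 2 * g * (sa * sb + sb * sc + sc * sa) +
     B * g ^+ 2 * (sa + sb + sc) * (a * b * c + a^* * b^* * c^*) +
     g ^+ 3 * ((a * b * c + a^* * b^* * c^*) ^+ 2 - 2%:R * (sa * sb * sc))).
    by rewrite pE qE rE /p /q /r /sa /sb /sc; ring.
  by rewrite /sa /sb /sc ha hb hc hz2 /t; field.
(* Each row of [A] is treated separately, a cyclic rotation moving its distinguished entry to the
   front. Summed over the rows, the forms give the trace of [L G]. *)
have hrow i : herm_form d p q r (A i ord0) (A i (lift ord0 ord0))
     (A i (lift ord0 (lift ord0 ord0))) >= A i i * (A i i)^*.
  have rot x y z : herm_form d q r p y z x = herm_form d p q r x y z.
    by rewrite /herm_form; ring.
  have i3 (j : 'I_3) : [\/ j = ord0, j = lift ord0 ord0 |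
      j = lift ord0 (lift ord0 ord0)].
    by case: j => [[|[|[|//]]] lj]; [constructor 1|constructor 2|constructor 3];
      apply/val_inj.
  have rot2 x y z : herm_form d r p q z x y = herm_form d p q r x y z.
    by rewrite /herm_form; ring.
  case: (i3 i) => ->.
  - exact: (normsq_le_herm_form _ _ _ d0 s0 pk qk rk pqr det0).
  - rewrite -rot; apply: (normsq_le_herm_form _ _ _ d0 s0 qk rk pk _ det0).
    by rewrite -pqr; ring.
  - rewrite -rot2; apply: (normsq_le_herm_form _ _ _ d0 s0 rk pk qk _ det0).
    by rewrite -pqr; ring.
apply: (le_trans (ler_sum _ (fun i _ => hrow i))).
have GE j l : \sum_i A i l * (A i j)^* = G j l.
  by rewrite mxE; apply: eq_bigr => i _; rewrite !mxE mulrC.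
rewrite le_eqVlt; apply/orP; left; apply/eqP.
transitivity (d * (G ord0 ord0 + G (lift ord0 ord0) (lift ord0 ord0) +
    G (lift ord0 (lift ord0 ord0)) (lift ord0 (lift ord0 ord0))) +
  (p * a + p^* * a^*) + (q * b + q^* * b^*) + (r * c + r^* * c^*)).
  have GC j l : (G j l)^* = G l j.
    by rewrite -!GE rmorph_sum; apply: eq_bigr => i _; rewrite rmorphM /= conjCK mulrC.
  rewrite /a /b /c !GC -!GE !sum3 /herm_form; ring.
rewrite !G1 pE qE rE.
transitivity (3%:R * d + 2%:R * B * (a * a^* + b * b^* + c * c^*)
   + 3%:R * g * (a * b * c + a^* * b^* * c^*)); first by rewrite /p /q /r; ring.
by rewrite ha hb hc hz2; field.
Qed.

Lemma triple_overlap_bound (A : 'M[C]_3) :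
  let G := A^t* *m A in
  let z := G ord0 (lift ord0 ord0)
    * G (lift ord0 ord0) (lift ord0 (lift ord0 ord0))
    * G (lift ord0 (lift ord0 ord0)) ord0 in
  (forall j, G j j = 1) ->
  (forall j l, j != l -> G j l * (G j l)^* = 4%:R^-1) ->
  z + z^* = 8%:R^-1 \/ z + z^* = - 4%:R^-1 ->
  \sum_i A i i * (A i i)^* <= 13%:R / 5%:R.
Proof.
move=> G z G1 G4 hz.
have frac_ge0 m n : 0 <= m%:R / n%:R :> C by rewrite divr_ge0 ?ler0n.
have frac_gt0 m n : 0 < m.+1%:R / n.+1%:R :> C by rewrite divr_gt0 ?ltr0n.
have rat_conj m n : (m%:R / n%:R : C)^* = m%:R / n%:R.
  by rewrite fmorph_div /= !rmorph_nat.
have G01 := G4 ord0 (lift ord0 ord0) isT.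
have G12 := G4 (lift ord0 ord0) (lift ord0 (lift ord0 ord0)) isT.
have G20 := G4 (lift ord0 (lift ord0 ord0)) ord0 isT.
case: hz => hz.
(* Phase +-pi/3: here [L = 7/3 - 2 G + (7/12) G^2], and the trace of [L G] is 1/160 below 13/5. *)
- have := @gram_trace_bound A (29%:R / 24%:R) (- (5%:R / 6%:R)) (7%:R / 12%:R)
    (16%:R^-1).
  move=> /(_ G1 G01 G12 G20) h.
  apply: (le_trans (h _ _ _ _ _ _)).
  + by rewrite -/z hz; field.
  + by rewrite rmorphN /= rat_conj.
  + exact: rat_conj.
  + exact: frac_gt0.
  + rewrite [X in 0 < X](_ : _ = 3055%:R / 2304%:R); first exact: frac_gt0.
    by field.
  + rewrite [X in 0 <= X](_ : _ = 223%:R / 110592%:R); first exact: frac_ge0.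
    by field.
  rewrite -subr_ge0 [X in 0 <= X](_ : _ = 1%:R / 160%:R); first exact: frac_ge0.
  by field.
(* Phase pi: [G] has eigenvalues 0, 3/2, 3/2, and the linear [L = 2 - (4/5) G] suffices. It is 2 on
   the kernel and 4/5 on the range, so [L G] has trace 12/5. *)
have := @gram_trace_bound A (6%:R / 5%:R) (- (4%:R / 5%:R)) 0 (- 8%:R^-1).
move=> /(_ G1 G01 G12 G20) h.
apply: (le_trans (h _ _ _ _ _ _)).
+ by rewrite -/z hz; field.
+ by rewrite rmorphN /= rat_conj.
+ exact: rmorph0.
+ exact: frac_gt0.
+ rewrite [X in 0 < X](_ : _ = 32%:R / 25%:R); first exact: frac_gt0.
  by field.
+ rewrite [X in 0 <= X](_ : _ = 0) //.
  by field.
rewrite -subr_ge0 [X in 0 <= X](_ : _ = 1%:R / 5%:R); first exact: frac_ge0.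
by field.
Qed.

End HermitianForm.

(** * Attainment of the threshold *)

Section Caratheodory.
Variables (R : realFieldType) (k m : nat) (x : 'I_m -> 'rV[R]_k).

(** More than [k] vectors in dimension [k] are dependent, and the sign of the relation can be chosen
    to make some coefficient positive. *)
Lemma conic_dependence (S : {set 'I_m}) : (k < #|S|)%N ->
  exists c : 'I_m -> R, [/\ forall l, l \notin S -> c l = 0,
    exists l, 0 < c l & \sum_l c l *: x l = 0].
Proof.
move=> kS; pose A := \matrix_(i < #|S|) x (enum_val i).
have : kermx A != 0.
  rewrite kermx_eq0 -row_leq_rank -ltnNge;
  exact: leq_ltn_trans (rank_leq_col _) kS.
case/rowV0Pn => u /sub_kermxP uA u0.
pose c l := \sum_(i < #|S| | enum_val i == l) u 0 i.
have c_out l : l \notin S -> c l = 0.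
  move=> lS; rewrite /c big1 // => i /eqP e; move: lS; rewrite -e enum_valP //.
have cE i : c (enum_val i) = u 0 i.
  by rewrite /c (big_pred1 i) // => j; rewrite (inj_eq enum_val_inj).
have cx : \sum_l c l *: x l = 0.
  transitivity (u *m A); last by [].
  rewrite mulmx_sum_row (bigID (fun l => l \in S)) /= addrC big1 ?add0r; last first.
    by move=> l lS; rewrite c_out // scale0r.
  rewrite big_enum_val; apply: eq_bigr => i _.
  by rewrite cE rowK.
have [i ui] : exists i, u 0 i != 0.
  apply/existsP; apply: contraNT u0; rewrite negb_exists => /forallP h.
  by apply/eqP/rowP => i; rewrite mxE; apply/eqP; have := h i; rewrite negbK.
case: (ltrgtP (u 0 i) 0) => [un|up|]; last by move=> e; rewrite e eqxx in ui.
  exists (fun l => - c l); split.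
  - by move=> l /c_out ->; rewrite oppr0.
  - by exists (enum_val i); rewrite cE oppr_gt0.
  - by under eq_bigr do rewrite scaleNr; rewrite sumrN cx oppr0.
exists c; split=> //; by exists (enum_val i); rewrite cE.
Qed.

(** Subtracting a multiple of a linear relation keeps the combination; the multiple is chosen to
    shrink the support, and induction on the size of the support concludes. *)
Lemma caratheodory_support (q : 'I_m -> R) : (forall l, 0 <= q l) ->
  exists q' : 'I_m -> R, [/\ forall l, 0 <= q' l,
    \sum_l q' l *: x l = \sum_l q l *: x l &
    (#|[set l | q' l != 0%R]| <= k)%N].
Proof.
have [n] := ubnP #|[set l | q l != 0]|.
elim: n q => // n IH q; rewrite ltnS => qn q0.
have [sk|ks] := leqP #|[set l | q l != 0]| k; first by exists q.
have [c [cout [l0 cl0] cx]] := conic_dependence ks.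
(* The least ratio over the positive coefficients is the largest step that keeps all weights
   nonnegative; it makes the weight at [l1] vanish. *)
case: (@arg_minP _ _ _ l0 (fun l => 0 < c l) (fun l => q l / c l) cl0)
  => l1 cl1 hmin.
pose t := q l1 / c l1.
have t0 : 0 <= t by rewrite divr_ge0 // ltW.
pose q2 l := q l - t * c l.
have q2l1 : q2 l1 = 0 by rewrite /q2 /t divfK ?subrr // gt_eqF.
have q20 l : 0 <= q2 l.
  rewrite subr_ge0; case: (ltP 0 (c l)) => [cl|cl].
    by rewrite -ler_pdivlMr //; apply: hmin.
  by apply: le_trans (q0 l); apply: mulr_ge0_le0.
have supp : ([set l | q2 l != 0] \subset [set l | q l != 0] :\ l1)%SET.
  apply/fintype.subsetP => l; rewrite !inE => h; apply/andP; split.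
    by apply: contraNneq h => ->; apply/eqP.
  by apply: contraNneq h => ql; rewrite /q2 ql cout ?mulr0 ?subrr // inE ql eqxx.
have l1S : l1 \in [set l | q l != 0].
  by apply: contraTT cl1 => /cout ->; rewrite ltxx.
have /IH : (#|[set l | q2 l != 0%R]| < n)%N.
  apply: leq_trans qn; rewrite (cardsD1 l1 [set l | q l != 0]) l1S ltnS.
  exact: subset_leq_card.
case=> // q' [h1 h2 h3]; exists q'; split=> //.
rewrite h2; under eq_bigr do rewrite scalerBl -scalerA.
by rewrite sumrB -scaler_sumr cx scaler0 subr0.
Qed.

End Caratheodory.

Local Open Scope complex_scope.

(** * Adjoints, positivity and entries of complex matrices *)

Section ComplexMatrices.
Variable R : realType.
Local Notation C := R[i].

Lemma psdmx_gram n m (A : 'M[C]_(n, m)) : psdmx (A *m A^t*).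
Proof.
split.
  by apply/is_hermitianmxP; rewrite expr0 scale1r trmx_mul map_mxM map_trmx trmxK
       -map_mx_comp (map_mx_id (@conjCK _)).
move=> x; rewrite mulmxA -mulmxA.
have -> : A^t* *m x = (x^t* *m A)^t*.
  by rewrite trmx_mul map_mxM map_trmx trmxK -map_mx_comp (map_mx_id (@conjCK _)).
rewrite mxE; apply: sumr_ge0 => k _.
by rewrite !mxE mul_conjC_ge0.
Qed.

Lemma conj_realC (x : R) : Num.conj (x%:C : C) = x%:C.
Proof. exact: conjc_real. Qed.

Lemma trmxCZ m n (c : C) (A : 'M[C]_(m, n)) : (c *: A)^t* = Num.conj c *: A^t*.
Proof. by rewrite linearZ /= map_mxZ. Qed.

Lemma trmxCM m n p (A : 'M[C]_(m, n)) (B : 'M[C]_(n, p)) :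
  (A *m B)^t* = B^t* *m A^t*.
Proof. by rewrite trmx_mul map_mxM. Qed.

Lemma trmxCE m n (A : 'M[C]_(m, n)) i j : (A^t*) i j = Num.conj (A j i).
Proof. by rewrite !mxE. Qed.

Lemma orthogonal_projection_psd (n : nat) (P : 'M[C]_n) :
  orthogonal_projection P -> psdmx P.
Proof.
case=> [/is_hermitianmxP]; rewrite expr0 scale1r => hP PP.
by rewrite -PP {2}hP; apply: psdmx_gram.
Qed.

Lemma depolariseE (d : nat) (v : R) (A : 'M[C]_d) i j : depolarise v A i j =
  v%:C * A i j + ((1 - v) / d%:R)%:C * \tr A * (i == j)%:R.
Proof. by rewrite !mxE mulr_natr. Qed.

End ComplexMatrices.

(** * Limits of bounded complex functions along an ultrafilter *)

Section UltraLimit.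
Local Open Scope classical_set_scope.
Variables (R : realType) (T : Type) (U : set_system T).
Hypothesis UU : UltraFilter U.
Local Notation C := R[i].

Let UP : ProperFilter U := @ultra_proper _ _ UU.
Local Existing Instance UP.

(** Compactness of the interval gives a cluster point. The ultrafilter contains each neighbourhood
    of it or the complement, and the complement cannot meet the neighbourhood. *)
Lemma bounded_ultra_cvg (u : T -> R) (a b : R) :
  (forall k, a <= u k <= b) -> exists l : R, u @ U --> l.
Proof.
move=> ub.
have := @segment_compact R a b (u @ U).
case.
- have h : U (u @^-1` `[a, b]).
    by apply: (filterS _ filterT) => k _; change (u k \in `[a, b]%R); rewrite in_itv /= ub.
  exact: h.
- move=> l [_ hl]; exists l => N Nl.
  case: (in_ultra_setVsetC (u @^-1` N) UU) => // h.
  by have [y [/= nNy Ny]] := hl (~` N) N h Nl.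
Qed.

(** Componentwise convergence reduces every limit to real-valued functions. *)
Definition ccvg (z : T -> C) (l : C) :=
  ((fun k => complex.Re (z k)) @ U --> complex.Re l) /\
  ((fun k => complex.Im (z k)) @ U --> complex.Im l).

Lemma ccvg_cst (c : C) : ccvg (fun=> c) c.
Proof. by split; apply: cvg_cst. Qed.

Lemma ccvg_real (u : T -> R) (l : R) : u @ U --> l ->
  ccvg (fun k => (u k)%:C) l%:C.
Proof. by move=> h; split => //=; apply: cvg_cst. Qed.

Lemma ccvgD z1 z2 l1 l2 : ccvg z1 l1 -> ccvg z2 l2 ->
  ccvg (fun k => z1 k + z2 k) (l1 + l2).
Proof.
move=> [a1 b1] [a2 b2]; split.
  have -> : (fun k => complex.Re (z1 k + z2 k)) =
     (fun k => complex.Re (z1 k)) + (fun k => complex.Re (z2 k)).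
    by apply/funext => k; rewrite raddfD.
  by rewrite raddfD; apply: cvgD.
have -> : (fun k => complex.Im (z1 k + z2 k)) =
   (fun k => complex.Im (z1 k)) + (fun k => complex.Im (z2 k)).
  by apply/funext => k; rewrite raddfD.
by rewrite raddfD; apply: cvgD.
Qed.

Lemma ccvgM z1 z2 l1 l2 : ccvg z1 l1 -> ccvg z2 l2 ->
  ccvg (fun k => z1 k * z2 k) (l1 * l2).
Proof.
move=> [a1 b1] [a2 b2]; split.
  have -> : (fun k => complex.Re (z1 k * z2 k)) =
     (fun k => complex.Re (z1 k)) \* (fun k => complex.Re (z2 k)) -
     (fun k => complex.Im (z1 k)) \* (fun k => complex.Im (z2 k)).
    by apply/funext => k; rewrite !fctE /=; case: (z1 k) (z2 k) => [p q] [r s].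
  have -> : complex.Re (l1 * l2) =
    complex.Re l1 * complex.Re l2 - complex.Im l1 * complex.Im l2.
    by case: (l1) (l2) => [p q] [r s].
  by apply: cvgB; apply: cvgM.
have -> : (fun k => complex.Im (z1 k * z2 k)) =
   (fun k => complex.Re (z1 k)) \* (fun k => complex.Im (z2 k)) +
   (fun k => complex.Im (z1 k)) \* (fun k => complex.Re (z2 k)).
  by apply/funext => k; rewrite !fctE /=; case: (z1 k) (z2 k) => [p q] [r s].
have -> : complex.Im (l1 * l2) =
  complex.Re l1 * complex.Im l2 + complex.Im l1 * complex.Re l2.
  by case: (l1) (l2) => [p q] [r s].
by apply: cvgD; apply: cvgM.
Qed.

Lemma ccvg_conj z l : ccvg z l -> ccvg (fun k => Num.conj (z k)) (Num.conj l).
Proof.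
move=> [a b]; split.
  have -> : (fun k => complex.Re (Num.conj (z k))) = (fun k => complex.Re (z k)).
    by apply/funext => k; case: (z k).
  by have -> : complex.Re (Num.conj l) = complex.Re l by case: (l).
have -> : (fun k => complex.Im (Num.conj (z k))) = - (fun k => complex.Im (z k)).
  by apply/funext => k /=; rewrite fctE; case: (z k).
have -> : complex.Im (Num.conj l) = - complex.Im l by case: (l).
exact: cvgN.
Qed.

Lemma ccvg_sum (I : Type) (s : seq I) (z : I -> T -> C) (l : I -> C) :
  (forall i, ccvg (z i) (l i)) ->
  ccvg (fun k => \sum_(i <- s) z i k) (\sum_(i <- s) l i).
Proof.
move=> h; elim: s => [|i s IH].
  rewrite big_nil (_ : (fun k => _) = fun=> 0); first exact: ccvg_cst.
  by apply/funext => k; rewrite big_nil.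
rewrite big_cons (_ : (fun k => _) = fun k => z i k + \sum_(j <- s) z j k).
  exact: ccvgD.
by apply/funext => k; rewrite big_cons.
Qed.

Lemma ccvg_unique z l1 l2 : ccvg z l1 -> ccvg z l2 -> l1 = l2.
Proof.
case: l1 l2 => [p q] [r s] [/= a1 b1] [/= a2 b2]; congr Complex.
  exact: (cvg_unique (@norm_hausdorff _ R) a1 a2).
exact: (cvg_unique (@norm_hausdorff _ R) b1 b2).
Qed.

Lemma norm_le1_ccvg (z : T -> C) :
  (forall k, `|z k| <= 1) -> exists l, ccvg z l.
Proof.
move=> h.
have hz k : (complex.Re (z k)) ^+ 2 + (complex.Im (z k)) ^+ 2 <= 1.
  by rewrite -lecR add_Re2_Im2 rmorph1 expr_le1.
have [a ha] : exists a : R, (fun k => complex.Re (z k)) @ U --> a.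
  apply: (@bounded_ultra_cvg _ (-1) 1) => k.
  have := hz k; set p := complex.Re _; set q := complex.Im _ => pq.
  by apply/andP; split; nra.
have [b hb] : exists b : R, (fun k => complex.Im (z k)) @ U --> b.
  apply: (@bounded_ultra_cvg _ (-1) 1) => k.
  have := hz k; set p := complex.Re _; set q := complex.Im _ => pq.
  by apply/andP; split; nra.
by exists (Complex a b); split.
Qed.

End UltraLimit.

(** * Simulations of bounded length and their limits *)

Section Threshold.
Variables (R : realType) (d n : nat).
Local Notation C := R[i].
Implicit Type E : 'I_n -> 'M[C]_d.

Lemma hermsymmxP (k : nat) (A : 'M[C]_k) :
  A \is hermsymmx -> forall i j, Num.conj (A j i) = A i j.
Proof.
by move=> /is_hermitianmxP; rewrite expr0 scale1r => {2}-> i j; rewrite !mxE.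
Qed.

(** Since [P = P P^t*], the entry [P k k] is the squared norm of row [k]. Hence
    [P k k ^+ 2 <= P k k], so [P k k <= 1], which bounds every entry of the row. *)
Lemma orthogonal_projection_entry (P : 'M[C]_d) i j :
  orthogonal_projection P -> `|P i j| <= 1.
Proof.
move=> [/hermsymmxP hP PP].
have e k : P k k = \sum_l `|P k l| ^+ 2.
  rewrite -{1}PP mxE; apply: eq_bigr => l _.
  by rewrite normCK hP.
have le k l : `|P k l| ^+ 2 <= P k k.
  rewrite e (bigD1 l) //= lerDl sumr_ge0 // => m _; exact: exprn_ge0.
have pos : 0 <= P i i by rewrite e sumr_ge0 // => m _; apply: exprn_ge0.
have d1 : P i i <= 1.
  have [->|nz] := eqVneq (P i i) 0; first exact: ler01.
  have := le i i; rewrite (ger0_norm pos) expr2 -[X in _ <= X]mulr1 ler_pM2l //.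
  by rewrite lt_def nz.
by rewrite -(@expr_le1 _ 2) //; apply: le_trans (le i j) d1.
Qed.

(** Real coordinates of a measurement. The extra coordinate [None] is constantly 1, so that a
    nonnegative combination with the same coordinates keeps its total weight and stays convex. *)
Definition coord_type := option ('I_n * 'I_d * 'I_d * bool).

Definition pm_coord (P : 'I_n -> 'M[C]_d) (c : coord_type) : R :=
  if c is Some (a, i, j, b) then
    if b then complex.Re (P a i j) else complex.Im (P a i j)
  else 1.

(** Caratheodory's bound in these coordinates makes the number of measurements depend on [n] and [d]
    only, so that a sequence of simulations has a common index set. *)
Lemma simulable_bounded E : projectively_simulable E ->
  exists (q : 'I_#|{: coord_type}| -> R)
         (P : 'I_#|{: coord_type}| -> 'I_n -> 'M[C]_d),
    [/\ forall l, 0 <= q l, \sum_l q l = 1,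
        forall l, projective_measurement (P l) &
        forall a, E a = \sum_l (q l)%:C *: P l a].
Proof.
set N := #|_|.
case=> m [q [P [q0 q1 hP hE]]].
pose x l : 'rV[R]_N := \row_j pm_coord (P l) (enum_val j).
have [q' [q'0 q'x q'N]] := caratheodory_support x q0.
have coordE c : \sum_l q' l * pm_coord (P l) c = \sum_l q l * pm_coord (P l) c.
  have /rowP/(_ (enum_rank c)) := q'x; rewrite !summxE => e.
  transitivity (\sum_l (q' l *: x l) 0 (enum_rank c)).
    by apply: eq_bigr => l _; rewrite !mxE enum_rankK.
  by rewrite e; apply: eq_bigr => l _; rewrite !mxE enum_rankK.
have q'1 : \sum_l q' l = 1.
  rewrite -q1; have := coordE None => /=.
  by under eq_bigr do rewrite mulr1; under [RHS]eq_bigr do rewrite mulr1.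
have q'E a : E a = \sum_l (q' l)%:C *: P l a.
  rewrite hE; apply/matrixP => i j; rewrite !summxE.
  have ReE (r : 'I_m -> R) : complex.Re (\sum_l ((r l)%:C *: P l a) i j) =
      \sum_l r l * pm_coord (P l) (Some (a, i, j, true)).
    rewrite raddf_sum; apply: eq_bigr => l _; rewrite mxE /=.
    by case: (P l a i j) => u v /=; rewrite mul0r subr0.
  have ImE (r : 'I_m -> R) : complex.Im (\sum_l ((r l)%:C *: P l a) i j) =
      \sum_l r l * pm_coord (P l) (Some (a, i, j, false)).
    rewrite raddf_sum; apply: eq_bigr => l _; rewrite mxE /=.
    by case: (P l a i j) => u v /=; rewrite mul0r addr0.
  by apply/eqP; rewrite eq_complex !ReE !ImE !coordE !eqxx.
(* The empty mixture has total weight 0; in the other case [ord0] serves as the default of [nth]. *)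
case: m => [|m] in q P q0 q1 hP hE x q' q'0 q'x q'N coordE q'1 q'E *.
  by move: q1; rewrite big_ord0 => /esym/eqP; rewrite oner_eq0.
set S := [set l | _]%SET in q'N.
pose s := enum S.
have sN : (size s <= N)%N by rewrite /s -cardE.
(* The support is listed as [s] and padded to length [N]; the padding positions carry weight 0 and
   the measurement [P ord0]. *)
have sumE (V : nmodType) (F : 'I_m.+1 -> V) : (forall l, q' l = 0 -> F l = 0) ->
    \sum_(i < N) (if (i < size s)%N then F (nth ord0 s i) else 0) = \sum_l F l.
  move=> F0; rewrite -big_mkcond /=.
  rewrite -(big_ord_widen N (fun i => F (nth ord0 s i)) sN).
  rewrite -(big_mkord xpredT (fun i => F (nth ord0 s i))) -(big_nth ord0 xpredT).
  rewrite /s big_enum /= [RHS](bigID (fun l => l \in S)) /= [X in _ + X]big1 ?addr0 //.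
  by move=> l; rewrite inE negbK => /eqP /F0.
exists (fun i => if (i < size s)%N then q' (nth ord0 s i) else 0).
exists (fun i => P (nth ord0 s i)); split.
- by move=> l; case: ifP.
- by rewrite sumE.
- by [].
move=> a; rewrite q'E -(sumE _ (fun l => (q' l)%:C *: P l a)); last first.
  by move=> l ->; rewrite scale0r.
by apply: eq_bigr => i _; case: ifP => // _; rewrite scale0r.
Qed.

Local Open Scope classical_set_scope.

(** Simulations at visibilities approaching the supremum have bounded weights and entries, and the
    conditions on them are equations and weak inequalities, which survive limits. *)
Lemma threshold_exists E : simulable_visibilities E !=set0 ->
  exists v, is_simulability_threshold E v.
Proof.
move=> S0; set S := simulable_visibilities E in S0.
have S1 : ubound S 1 by move=> v [/andP[]].
have hS : has_sup S by split=> //; exists 1.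
exists (sup S); split; last by apply: ub_le_sup; exists 1.
have /choice[v hv] (k : nat) : exists v, S v /\ sup S - k.+1%:R^-1 < v.
  have pos : (0 : R) < k.+1%:R^-1 by rewrite invr_gt0.
  by have [v Sv lv] := sup_adherent pos hS; exists v.
have vS k : v k <= sup S by apply: ub_le_sup; [exists 1|case: (hv k)].
have /choice[q /choice[P hqP]] (k : nat) := simulable_bounded (proj2 (proj1 (hv k))).
(* A single ultrafilter finer than [\oo] makes all weights and entries converge at once. *)
have [U [UU ooU]] := @ultraFilterLemma nat \oo _.
have UP : ProperFilter U := @ultra_proper _ _ UU.
have cv : v @ U --> sup S.
  apply: (@cvg_trans _ (v @ \oo)); first exact: cvg_app.
  apply: (@squeeze_cvgr _ _ _ _ (fun k => sup S - harmonic k) (fun=> sup S)).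
  - by near=> k; rewrite vS andbT ltW //; case: (hv k).
  - by rewrite -[X in _ --> X]subr0; apply: cvgB; [exact: cvg_cst|exact: cvg_harmonic].
  - exact: cvg_cst.
have q01 k l : 0 <= q k l <= 1.
  have [h0 h1 _ _] := hqP k; rewrite h0 /= -h1 (bigD1 l) //= lerDl.
  by apply: sumr_ge0.
have /choice[q' hq'] l : exists q' : R, (fun k => q k l) @ U --> q'.
  exact: (@bounded_ultra_cvg _ _ _ UU _ 0 1).
have hP k l a : orthogonal_projection (P k l a).
  by have [_ _ /(_ l)[_ /(_ a)]] := hqP k.
have /choice[P' hP'] (t : 'I_#|{: coord_type}| * 'I_n * 'I_d * 'I_d) :
    exists z : C, ccvg U (fun k => P k t.1.1.1 t.1.1.2 t.1.2 t.2) z.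
  by apply: norm_le1_ccvg => // k; apply: orthogonal_projection_entry.
pose Q l a : 'M[C]_d := \matrix_(i, j) P' (l, a, i, j).
have cP l a i j : ccvg U (fun k => P k l a i j) (Q l a i j).
  by rewrite mxE; apply: hP' (l, a, i, j).
have hQ l a : orthogonal_projection (Q l a).
  split.
    apply/is_hermitianmxP; rewrite expr0 scale1r; apply/matrixP => i j.
    rewrite [RHS]mxE [in RHS]mxE.
    apply: (ccvg_unique UU (cP l a i j)).
    rewrite (_ : (fun k => _) = (fun k => Num.conj (P k l a j i))).
      exact: ccvg_conj.
    by apply/funext => k; rewrite (hermsymmxP (proj1 (hP k l a))).
  apply/matrixP => i j; apply: (ccvg_unique UU _ (cP l a i j)).
  rewrite (_ : (fun k => _) = (fun k => \sum_m P k l a i m * P k l a m j)).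
    by rewrite mxE; apply: ccvg_sum => m; apply: ccvgM.
  by apply/funext => k; rewrite -{1}(proj2 (hP k l a)) mxE.
have psdQ l a : psdmx (Q l a).
  exact: orthogonal_projection_psd.
split.
  apply/andP; split.
    have [[/andP[h _] _] _] := hv 0%N; exact: le_trans h (vS _).
  by apply: ge_sup.
exists #|{: coord_type}|, q', Q; split.
- move=> l; rewrite -(cvg_lim (@norm_hausdorff _ R) (hq' l)).
  apply: limr_ge; first by apply/cvg_ex; exists (q' l).
  by near=> k; case/andP: (q01 k l).
- apply: (@complexI R); rewrite rmorph_sum rmorph1.
  apply: (ccvg_unique UU (z := fun k => \sum_l (q k l)%:C)).
    by apply: ccvg_sum => l; apply: ccvg_real.
  rewrite (_ : (fun k => _) = fun=> 1); first exact: ccvg_cst.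
  by apply/funext => k; have [_ h _ _] := hqP k; rewrite -rmorph_sum h.
- move=> l; split; last by [].
  split=> //; apply/matrixP => i j; rewrite summxE.
  apply: (ccvg_unique UU (z := fun k => \sum_a P k l a i j)).
    exact: ccvg_sum.
  rewrite (_ : (fun k => _) = fun=> (1%:M : 'M[C]_d) i j); first exact: ccvg_cst.
  apply/funext => k; have [_ _ /(_ l)[[_ <-] _] _] := hqP k.
  by rewrite summxE.
move=> a; apply/matrixP => i j.
apply: (ccvg_unique UU (z := fun k => depolarise (v k) (E a) i j)).
  rewrite (_ : (fun k => _) = (fun k => (v k)%:C * E a i j +
     ((1 - v k) / d%:R)%:C * \tr (E a) * (i == j)%:R)).
    rewrite depolariseE; apply: ccvgD; first by apply: ccvgM; [apply: ccvg_real|apply: ccvg_cst].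
    apply: ccvgM; last exact: ccvg_cst.
    apply: ccvgM; last exact: ccvg_cst.
    apply: ccvg_real; apply: cvgM; last exact: cvg_cst.
    by apply: cvgB; [exact: cvg_cst|].
  by apply/funext => k; rewrite depolariseE.
rewrite summxE.
rewrite (_ : (fun k => _) = (fun k => \sum_l (q k l)%:C * P k l a i j)).
  have -> : \sum_l ((q' l)%:C *: Q l a) i j = \sum_l (q' l)%:C * Q l a i j.
    by apply: eq_bigr => l _; rewrite mxE.
  by apply: ccvg_sum => l; apply: ccvgM => //; apply: ccvg_real.
apply/funext => k; have [_ _ _ ->] := hqP k.
by rewrite summxE; apply: eq_bigr => l _; rewrite mxE.
Unshelve. all: by end_near.
Qed.

End Threshold.

(** * The overlap functional on projective measurements *)

Section ProjectiveMeasurement.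
Variable R : realType.
Local Notation C := R[i].

(** Compressing [sum_c P c = 1] by [P b] and cancelling the term [c = b] shows that the positive
    matrices [P b P c P b], [c != b], sum to 0. Each is the Gram matrix of the rows of [P b P c], so
    these rows vanish. *)
Lemma projective_measurement_ortho d n (P : 'I_n -> 'M[C]_d) a b :
  projective_measurement P -> a != b -> P b *m P a = 0.
Proof.
move=> [[_ sumP] hP] ab.
have hermP c : (P c)^t* = P c.
  have [/is_hermitianmxP h _] := hP c.
  by rewrite [in RHS]h expr0 scale1r.
have PP c : P c *m P c = P c by have [] := hP c.
have : \sum_(c | c != b) (P b *m P c) *m (P b *m P c)^t* = 0.
  have e c : P b *m P c *m (P b *m P c)^t* = P b *m P c *m P b.
    by rewrite trmxCM !hermP !mulmxA -(mulmxA (P b)) PP.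
  under eq_bigr do rewrite e.
  apply: (addrI (P b)); rewrite addr0.
  transitivity (\sum_c P b *m P c *m P b).
    by rewrite [RHS](bigD1 b) //= !PP.
  by rewrite -mulmx_suml -mulmx_sumr sumP mulmx1 PP.
move=> /matrixP h; apply/matrixP => i j; rewrite [RHS]mxE.
have := h i i; rewrite summxE [RHS]mxE => /psumr_eq0P.
have nn c : 0 <= (P b *m P c *m (P b *m P c) ^t*) i i.
  by rewrite mxE sumr_ge0 // => l _; rewrite trmxCE mul_conjC_ge0.
move=> /(_ (fun c _ => nn c) a ab); rewrite mxE => /psumr_eq0P.
have nn2 l : 0 <= (P b *m P a) i l * (P b *m P a) ^t* l i.
  by rewrite trmxCE mul_conjC_ge0.
move=> /(_ (fun l _ => nn2 l) j isT).
rewrite trmxCE => /eqP.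
by rewrite mul_conjC_eq0 => /eqP.
Qed.

(** The nonzero effects are the spectral projections of [H = sum_a a P_a], whose eigenvalues [a] are
    distinct. The rows of [V] form an orthonormal eigenbasis, and the eigenvalue of a row is its
    label. *)
Lemma projective_measurement_basis d n (P : 'I_n -> 'M[C]_d) :
  projective_measurement P ->
  exists (V : 'M[C]_d) (lab : 'I_d -> 'I_n), V *m V^t* = 1%:M /\
    forall a i j, (V *m P a) i j = if lab i == a then V i j else 0.
Proof.
move=> hP; have [[_ sumP] projP] := hP.
pose H := \sum_(a < n) (a%:R : C) *: P a.
have hermH : H \is hermsymmx.
  apply/is_hermitianmxP; rewrite expr0 scale1r /H linear_sum /= map_mx_sum.
  apply: eq_bigr => a _; have [/is_hermitianmxP h _] := projP a.
  by rewrite linearZ /= map_mxZ {1}h expr0 scale1r /= rmorph_nat.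
have HP b : H *m P b = b%:R *: P b.
  rewrite /H mulmx_suml (bigD1 b) //= -scalemxAl (proj2 (projP b)).
  rewrite big1 ?addr0 // => a ab.
  by rewrite -scalemxAl (projective_measurement_ortho hP) ?scaler0 // eq_sym.
pose V := spectralmx H; pose D := spectral_diag H.
have Vu : V \is unitarymx := spectral_unitarymx H.
have VH : V *m H = diag_mx D *m V.
  have /orthomx_spectralP e := hermitian_normalmx hermH.
  by rewrite [in LHS]e !mulmxA mulmxV ?mul1mx // spectral_unit.
have eig (b : 'I_n) i j : (b%:R - D 0 i) * (V *m P b) i j = 0.
  have /matrixP/(_ i j) : V *m H *m P b = diag_mx D *m (V *m P b).
    by rewrite VH mulmxA.
  rewrite -mulmxA HP -scalemxAr mul_diag_mx [LHS]mxE [RHS]mxE => e.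
  by rewrite mulrBl e subrr.
have sumV i j : \sum_a (V *m P a) i j = V i j.
  by rewrite -summxE -mulmx_sumr sumP mulmx1.
have VV : V *m V^t* = 1%:M by apply/unitarymxP.
have /fin_all_exists[lab hlab] (i : 'I_d) :
    exists a, forall b j, (V *m P b) i j = if a == b then V i j else 0.
  (* A row of [V] is the sum of its images under the effects; as it is a unit vector, some effect
     does not kill it. *)
  have [[a j] /= nz | z] := pickP (fun t : 'I_n * 'I_d => (V *m P t.1) i t.2 != 0).
    exists a.
    have Da : D 0 i = a%:R.
      have /eqP := eig a i j.
      by rewrite mulf_eq0 (negbTE nz) orbF subr_eq0 => /eqP.
    have off b l : a != b -> (V *m P b) i l = 0.
      move=> ab; have /eqP := eig b i l; rewrite mulf_eq0 Da subr_eq0 eqr_nat.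
      by rewrite eq_sym (negbTE (ab : a != b :> nat)) => /eqP.
    move=> b l; case: eqVneq => [<-|]; last exact: off.
    by rewrite -[RHS]sumV (bigD1 a) //= big1 ?addr0 // => c ca; rewrite off // eq_sym.
  have V0 j : V i j = 0.
    by rewrite -sumV big1 // => a _; apply/eqP; have /negbFE := z (a, j).
  have /matrixP/(_ i i) := VV; rewrite mxE big1 => [|j _].
    by rewrite mxE eqxx => /eqP; rewrite eq_sym oner_eq0.
  by rewrite V0 mul0r.
by exists V, lab.
Qed.

Lemma sum_overlap_basis d n (P : 'I_n -> 'M[C]_d) (V : 'M[C]_d)
    (lab : 'I_d -> 'I_n) (psi : 'I_n -> 'cV[C]_d) :
  V *m V^t* = 1%:M ->
  (forall a i j, (V *m P a) i j = if lab i == a then V i j else 0) ->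
  \sum_a ((psi a)^t* *m P a *m psi a) 0 0 =
  \sum_i (V *m psi (lab i)) i 0 * Num.conj ((V *m psi (lab i)) i 0).
Proof.
move=> VV hV; have VV2 : V^t* *m V = 1%:M by apply: mulmx1C.
have e a : ((psi a)^t* *m P a *m psi a) 0 0 = \sum_i (if lab i == a then
    (V *m psi a) i 0 * Num.conj ((V *m psi a) i 0) else 0).
  have -> : (psi a)^t* *m P a *m psi a = (V *m psi a)^t* *m (V *m P a *m psi a).
    by rewrite trmxCM !mulmxA -(mulmxA _ (V^t*)) VV2 mulmx1.
  rewrite mxE; apply: eq_bigr => i _.
  have -> : (V *m P a *m psi a) i 0 = if lab i == a then (V *m psi a) i 0 else 0.
    rewrite mxE; under eq_bigr do rewrite hV.
    by case: ifP => _; [rewrite mxE|rewrite big1 // => j _; rewrite mul0r].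
  case: ifP => _; last by rewrite mulr0.
  by rewrite trmxCE mulrC.
under eq_bigr do rewrite e.
rewrite exchange_big; apply: eq_bigr => i _.
by rewrite -big_mkcond (big_pred1 (lab i)) //= => a; rewrite eq_sym.
Qed.

(** For overlaps of modulus 1/2 the product [z] has modulus 1/8, so the two values mean phase +-pi/3
    and phase pi. *)
Definition phase_condition n (psi : 'I_n -> 'cV[C]_3) : Prop :=
  forall a b c, a != b -> b != c -> c != a ->
  let z := ((psi a)^t* *m psi b) 0 0 * ((psi b)^t* *m psi c) 0 0
           * ((psi c)^t* *m psi a) 0 0 in
  z + Num.conj z = 8%:R^-1 \/ z + Num.conj z = - 4%:R^-1.

(** If two basis vectors share a label, their terms add up to at most 1 and the total is at most 2.
    With three distinct labels the Gram matrix bound applies. Effects of any rank are covered, as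
    labels may repeat or be absent. *)
Lemma projective_overlap_bound n (P : 'I_n -> 'M[C]_3)
    (psi : 'I_n -> 'cV[C]_3) :
  projective_measurement P ->
  (forall a, ((psi a)^t* *m psi a) 0 0 = 1) ->
  (forall a b, a != b -> `|((psi a)^t* *m psi b) 0 0| ^+ 2 = 4%:R^-1) ->
  phase_condition psi ->
  \sum_a ((psi a)^t* *m P a *m psi a) 0 0 <= 13%:R / 5%:R.
Proof.
move=> hP psi1 psi4 phase.
have [V [lab [VV hV]]] := projective_measurement_basis hP.
have VV2 : V^t* *m V = 1%:M by apply: mulmx1C.
rewrite (sum_overlap_basis _ VV hV).
pose f a i := (V *m psi a) i 0 * Num.conj ((V *m psi a) i 0).
have f0 a i : 0 <= f a i by apply: mul_conjC_ge0.
have f1 a : \sum_i f a i = 1.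
  have : ((V *m psi a)^t* *m (V *m psi a)) 0 0 = 1.
    by rewrite trmxCM !mulmxA -(mulmxA _ (V^t*)) VV2 mulmx1.
  rewrite mxE => <-; apply: eq_bigr => i _.
  by rewrite /f trmxCE mulrC.
rewrite -[X in X <= _]/(\sum_i f (lab i) i).
set i0 : 'I_3 := ord0; set i1 : 'I_3 := lift ord0 ord0.
set i2 : 'I_3 := lift ord0 (lift ord0 ord0).
have f3 a := f1 a; rewrite sum3 -/i0 -/i1 -/i2.
have le1 a i : f a i <= 1.
  by rewrite -(f1 a) (bigD1 i) //= lerDl sumr_ge0.
have le2 a i j : i != j -> f a i + f a j <= 1.
  by move=> ij; rewrite -(f1 a) (bigD1 i) // lerD2l (bigD1 j) 1?eq_sym //= lerDl sumr_ge0.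
have le13 (x y : C) : x <= 1 -> y <= 1 -> x + y <= 13%:R / 5%:R.
  move=> x1 y1; apply: (le_trans (lerD x1 y1)); rewrite -subr_ge0.
  by rewrite [X in 0 <= X](_ : _ = 3%:R / 5%:R) ?divr_ge0 ?ler0n //; field.
have [e01|n01] := eqVneq (lab i0) (lab i1).
  by rewrite e01; apply: le13 => //; apply: le2.
have [e12|n12] := eqVneq (lab i1) (lab i2).
  by rewrite -addrA [X in X <= _]addrC e12; apply: le13 => //; apply: le2.
have [e20|n20] := eqVneq (lab i2) (lab i0).
  by rewrite addrAC e20; apply: le13 => //; apply: le2.
pose A : 'M[C]_3 := \matrix_(i, j) (V *m psi (lab j)) i 0.
have GE j l : (A^t* *m A) j l = ((psi (lab j))^t* *m psi (lab l)) 0 0.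
  transitivity (((V *m psi (lab j))^t* *m (V *m psi (lab l))) 0 0).
    rewrite [LHS]mxE [RHS]mxE; apply: eq_bigr => i _.
    by rewrite !trmxCE ![A _ _]mxE.
  by rewrite trmxCM !mulmxA -(mulmxA _ (V^t*)) VV2 mulmx1.
have labI j l : j != l -> lab j != lab l.
  have i3 (i : 'I_3) : [\/ i = i0, i = i1 | i = i2].
    by case: i => [[|[|[|//]]] li]; [constructor 1|constructor 2|constructor 3];
      apply/val_inj.
  by case: (i3 j) => ->; case: (i3 l) => ->; rewrite ?eqxx // => _; rewrite // eq_sym.
have := @triple_overlap_bound _ A.
rewrite sum3 -/i0 -/i1 -/i2 ![A _ _]mxE; apply.
- by move=> j; rewrite GE psi1.
- by move=> j l jl; rewrite GE -normCK psi4 // labI.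
- by rewrite !GE; apply: phase.
Qed.

(** Each of the nine terms of the functional equals [v / 3 + (1 - v) / 9], so their sum is
    [1 + 2 v], which is at most 13/5. *)
Lemma visibility_bound (E : 'I_9 -> 'M[C]_3) (psi : 'I_9 -> 'cV[C]_3) (v : R) :
  (forall a, ((psi a)^t* *m psi a) 0 0 = 1) ->
  (forall a b, a != b -> `|((psi a)^t* *m psi b) 0 0| ^+ 2 = 4%:R^-1) ->
  (forall a, E a = 3%:R^-1 *: (psi a *m (psi a)^t*)) ->
  phase_condition psi ->
  projectively_simulable (fun a => depolarise v (E a)) -> v <= 4%:R / 5%:R.
Proof.
move=> psi1 psi4 EE phase [m [q [P [q0 q1 hP hE]]]].
have psiD a : ((psi a)^t* *m depolarise v (E a) *m psi a) 0 0 =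
    (v / 3%:R + (1 - v) / 9%:R)%:C.
  have trE : \tr (E a) = 3%:R^-1.
    by rewrite EE mxtraceZ mxtrace_mulC /mxtrace big_ord1 psi1 mulr1.
  have N1 : (psi a)^t* *m psi a = 1%:M by rewrite [LHS]mx11_scalar psi1.
  rewrite /depolarise trE EE mulmxDr mulmxDl -!scalemxAr -!scalemxAl.
  rewrite mulmx1 !mulmxA N1 mul1mx N1 !mxE eqxx.
  rewrite rmorphD !rmorphM !fmorphV rmorphB /= !rmorph_nat rmorph1.
  by field.
have le : \sum_a ((psi a)^t* *m depolarise v (E a) *m psi a) 0 0 <= 13%:R / 5%:R.
  have -> : \sum_a ((psi a)^t* *m depolarise v (E a) *m psi a) 0 0 =
      \sum_l (q l)%:C * \sum_a ((psi a)^t* *m P l a *m psi a) 0 0.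
    under [RHS]eq_bigr do rewrite mulr_sumr.
    rewrite exchange_big; apply: eq_bigr => a _.
    rewrite hE mulmx_sumr mulmx_suml summxE; apply: eq_bigr => l _.
    by rewrite -scalemxAr -scalemxAl mxE.
  apply: (@le_trans _ _ (\sum_l (q l)%:C * (13%:R / 5%:R))).
    apply: ler_sum => l _; apply: ler_wpM2l; first by rewrite ler0c.
    exact: projective_overlap_bound.
  by rewrite -mulr_suml -rmorph_sum q1 mul1r.
move: le; under eq_bigr do rewrite psiD.
rewrite sumr_const card_ord -rmorphMn /=.
have -> : 13%:R / 5%:R = (13%:R / 5%:R)%:C :> C.
  by rewrite rmorphM fmorphV /= !rmorph_nat.
by rewrite lecR -mulr_natl => h; lra.
Qed.

End ProjectiveMeasurement.

(** * Certificates over the Eisenstein integers *)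

(* (a, b) stands for a + b omega, where omega^2 = - 1 - omega. *)
Definition eis := (Z * Z)%type.
Definition eis0 : eis := (0%ZZ, 0%ZZ).
Definition eisZ (n : Z) : eis := (n, 0%ZZ).
Definition eis_add (x y : eis) : eis := ((x.1 + y.1)%ZZ, (x.2 + y.2)%ZZ).
Definition eis_mul (x y : eis) : eis :=
  ((x.1 * y.1 - x.2 * y.2)%ZZ, (x.1 * y.2 + x.2 * y.1 - x.2 * y.2)%ZZ).
Definition eis_conj (x : eis) : eis := ((x.1 - x.2)%ZZ, (- x.2)%ZZ).
Definition eis_eqb (x y : eis) : bool := Z.eqb x.1 y.1 && Z.eqb x.2 y.2.
Definition eis_sum (T : Type) (s : seq T) (F : T -> eis) : eis :=
  foldr (fun x acc => eis_add (F x) acc) eis0 s.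
Definition eis_vec := seq eis.
Definition vcoef (f : eis_vec) (i : nat) : eis := nth eis0 f i.
Definition eis_dot (f g : eis_vec) : eis :=
  eis_sum (iota 0 3) (fun i => eis_mul (eis_conj (vcoef f i)) (vcoef g i)).

(* A weight, and labelled vectors (a, f, c): the measurement whose a-th effect
   is the sum of the matrices c f f^* / D over the triples labelled a, for a
   common denominator D. *)
Definition pm_code := (Z * seq (nat * eis_vec * Z))%type.
Definition pm_entry (p : pm_code) (a i j : nat) : eis :=
  eis_sum [seq x <- p.2 | x.1.1 == a] (fun x =>
    eis_mul (eisZ x.2) (eis_mul (vcoef x.1.2 i) (eis_conj (vcoef x.1.2 j)))).

(** [pm_entry] is [D] times the effect, so idempotence reads [X X = D X] and the effects sum to
    [D]. *)
Definition pm_check (D : Z) (p : pm_code) : bool :=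
  [&& Z.leb 0 p.1,
  all (fun a => all (fun i => all (fun j =>
    eis_eqb (pm_entry p a i j) (eis_conj (pm_entry p a j i)) &&
    eis_eqb (eis_sum (iota 0 3) (fun k =>
                 eis_mul (pm_entry p a i k) (pm_entry p a k j)))
            (eis_mul (eisZ D) (pm_entry p a i j)))
    (iota 0 3)) (iota 0 3)) (iota 0 9) &
  all (fun i => all (fun j =>
    eis_eqb (eis_sum (iota 0 9) (fun a => pm_entry p a i j))
            (if i == j then eisZ D else eis0))
    (iota 0 3)) (iota 0 3)].

Definition mixture_check (W x y : Z) (phi : seq eis_vec) (ps : seq pm_code) :
    bool :=
  Z.eqb (foldr (fun p acc => (p.1 + acc)%ZZ) 0%ZZ ps) W &&
  all (fun a => all (fun i => all (fun j =>
    eis_eqb (eis_sum ps (fun p => eis_mul (eisZ p.1) (pm_entry p a i j)))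
     (eis_add (eis_mul (eisZ x) (eis_mul (vcoef (nth [::] phi a) i)
                                   (eis_conj (vcoef (nth [::] phi a) j))))
              (if i == j then eisZ y else eis0)))
    (iota 0 3)) (iota 0 3)) (iota 0 9).

Definition zeta (k : nat) : eis :=
  nth eis0 [:: (1%ZZ, 0%ZZ); (0%ZZ, 1%ZZ); ((-1)%ZZ, (-1)%ZZ)] (k %% 3).

(* The orbit of (0, 1, e); the unit vectors are these divided by sqrt 2. *)
Definition sic_vec (e : eis) (a : nat) : eis_vec :=
  let z := (a %/ 3)%N in let q := (a %% 3)%N in
  [seq (if i == z then eis0
        else if i == (z.+1 %% 3)%N then eisZ 1 else eis_mul e (zeta q))
  | i <- iota 0 3].
Definition sic_vecs (e : eis) : seq eis_vec :=
  [seq sic_vec e a | a <- iota 0 9].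

(** For vectors of squared norm 2 this is equality in Cauchy-Schwarz: it finds the SIC vector
    proportional to [f], whatever its phase. *)
Definition label_of (phi : seq eis_vec) (f : eis_vec) : nat :=
  find (fun g => let d := eis_dot g f in
                 eis_eqb (eis_mul d (eis_conj d)) (eisZ 4)) phi.

Definition monomial (s : seq nat) (k : seq nat) (f : eis_vec) : eis_vec :=
  [seq eis_mul (zeta (nth 0%N k i)) (vcoef f (nth 0%N s i)) | i <- iota 0 3].

Definition perms3 : seq (seq nat) :=
  [:: [:: 0; 1; 2]; [:: 1; 2; 0]; [:: 2; 0; 1];
      [:: 0; 2; 1]; [:: 2; 1; 0]; [:: 1; 0; 2]]%N.

(** Monomial matrices with cube roots of unity as entries, modulo scalars: fixing the first phase
    leaves 6 * 9 = 54 of them. They permute the lines of the orbit of (0, 1, 1). *)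
Definition monomial_orbit (phi : seq eis_vec) (c : Z)
    (b : seq (eis_vec * eis_vec * Z)) : seq pm_code :=
  [seq (c, [seq (label_of phi (monomial s k x.1.1), monomial s k x.1.2, x.2)
           | x <- b]) | s <- perms3,
    k <- [seq [:: 0%N; k1; k2] | k1 <- iota 0 3, k2 <- iota 0 3]].

(* a + b i sqrt 3 *)
Definition eisI3 (a b : Z) : eis := ((a + b)%ZZ, (2 * b)%ZZ).

(* Each entry is a SIC vector, the basis vector f assigned to it, and 2700/|f|^2.
   This basis is the unitary polar factor of three vectors of phase 0. *)
Definition phase0_basis : seq (eis_vec * eis_vec * Z) :=
  [:: ([:: eis0; zeta 0; zeta 0], [seq eisZ n | n <- [:: -1; 2; 2]%ZZ], 300%ZZ);
      ([:: zeta 0; eis0; zeta 0], [seq eisZ n | n <- [:: 2; -1; 2]%ZZ], 300%ZZ);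
      ([:: zeta 0; zeta 0; eis0], [seq eisZ n | n <- [:: 2; 2; -1]%ZZ], 300%ZZ)].
(* An integral basis close to the optimal one for a triple of phase pi/3, with
   the first two vectors conjugate. *)
Definition phase60_basis : seq (eis_vec * eis_vec * Z) :=
  let f := [:: eisI3 10 0; eisI3 (-5) 21; eisI3 (-35) (-3)] in
  [:: ([:: eis0; zeta 0; zeta 1], f, 1%ZZ);
      ([:: eis0; zeta 0; zeta 2], [seq eis_conj x | x <- f], 1%ZZ);
      ([:: zeta 0; eis0; zeta 0], [seq eisZ n | n <- [:: 25; 1; 7]%ZZ], 4%ZZ)].
(** Averaging makes each effect diagonal in the basis formed by its SIC vector, the coordinate
    vector at its zero, and the vector orthogonal to both. The last two eigenvalues must agree. They
    are in proportion 900 : 0 for the first orbit and 204 : 984 for the second, on a common scale,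
    whence [900 * 13 = (984 - 204) * 15]. *)
Definition sic1_measurements : seq pm_code :=
  monomial_orbit (sic_vecs (eisZ 1)) 13 phase0_basis ++ monomial_orbit (sic_vecs (eisZ 1)) 15 phase60_basis.

(** The measurement that always answers [a], its identity effect being split along the coordinate
    vectors. The uniform mixture simulates visibility 0, so the set of visibilities is nonempty. *)
Definition trivial_measurements : seq pm_code :=
  [seq (1%ZZ, [seq (a, e, 1%ZZ) | e <- [:: [:: zeta 0]; [:: eis0; zeta 0];
                                          [:: eis0; eis0; zeta 0]]])
  | a <- iota 0 9].

(** With vectors of squared norm 2, triple products are 8 times the normalised ones: 1 and -2 stand
    for 1/8 and -1/4. *)
Definition phase_check (phi : seq eis_vec) : bool :=
  all (fun a => all (fun b => all (fun c =>
    let dot x y := eis_dot (nth [::] phi x) (nth [::] phi y) in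
    let z := eis_mul (eis_mul (dot a b) (dot b c)) (dot c a) in
    let t := eis_add z (eis_conj z) in
    [|| a == b, b == c, c == a, eis_eqb t (eisZ 1) | eis_eqb t (eisZ (-2))])
    (iota 0 9)) (iota 0 9)) (iota 0 9).

(** For vectors of squared norm 2, the squared overlap 1/4 becomes 1, and the ket-bras, which sum to
    3 when normalised, sum to 6. *)
Definition sic_check (phi : seq eis_vec) : bool :=
  all (fun a => all (fun b =>
    let d := eis_dot (nth [::] phi a) (nth [::] phi b) in
    eis_eqb (eis_mul (eis_conj d) d) (eisZ (if a == b then 4 else 1)))
    (iota 0 9)) (iota 0 9) &&
  all (fun a => eis_eqb (eis_dot (nth [::] phi a) (nth [::] phi a)) (eisZ 2))
      (iota 0 9) &&
  all (fun i => all (fun j =>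
    eis_eqb (eis_sum phi (fun f =>
               eis_mul (vcoef f i) (eis_conj (vcoef f j))))
            (if i == j then eisZ 6 else eis0))
    (iota 0 3)) (iota 0 3).

Lemma sic_check1 : sic_check (sic_vecs (eisZ 1)). Proof. by vm_compute. Qed.

Lemma sic_checkN1 : sic_check (sic_vecs (eisZ (-1))).
Proof. by vm_compute. Qed.

Lemma phase_checkN1 : phase_check (sic_vecs (eisZ (-1))).
Proof. by vm_compute. Qed.

Lemma sic1_measurements_check : all (pm_check 2700) sic1_measurements.
Proof. by vm_compute. Qed.

(* At v = 169/210 the constants are D W v / 6 and D W (1 - v) / 9, for D = 2700
   and total weight W = 54 (13 + 15). *)
Lemma sic1_mixture_check : mixture_check 1512 547560 88560 (sic_vecs (eisZ 1)) sic1_measurements.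
Proof. by vm_compute. Qed.

Lemma trivial_measurements_check : all (pm_check 1) trivial_measurements.
Proof. by vm_compute. Qed.

Lemma trivial_mixture_check :
  mixture_check 9 0 1 (sic_vecs (eisZ (-1))) trivial_measurements.
Proof. by vm_compute. Qed.

(** * Interpretation of the certificates as complex matrices *)

Section Transport.
Variable R : realType.
Local Notation C := R[i].

Definition omega : C := Complex (- 2%:R^-1) (Num.sqrt 3%:R / 2%:R).

Lemma omega_sqr : omega * omega = - 1 - omega.
Proof.
apply/eqP; rewrite eq_complex /=; apply/andP; split; apply/eqP.
  have h : Num.sqrt 3%:R * Num.sqrt 3%:R = 3%:R :> R by rewrite -expr2 sqr_sqrtr.
  have -> : Num.sqrt 3%:R / 2%:R * (Num.sqrt 3%:R / 2%:R) = 3%:R / 4%:R :> R.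
    by rewrite mulrACA h; field.
  by field.
by field.
Qed.

Lemma omega_conj : Num.conj omega = - 1 - omega.
Proof.
by apply/eqP; rewrite eq_complex /=; apply/andP; split; apply/eqP; field.
Qed.

Definition ZC (n : Z) : C := (int_of_Z n)%:~R.
Definition eisC (x : eis) : C := ZC x.1 + ZC x.2 * omega.

Lemma ZC_D m n : ZC (m + n)%ZZ = ZC m + ZC n.
Proof. by rewrite /ZC -intrD -[in RHS]rmorphD. Qed.
Lemma ZC_M m n : ZC (m * n)%ZZ = ZC m * ZC n.
Proof. by rewrite /ZC -intrM -[in RHS]rmorphM. Qed.
Lemma ZC_N m : ZC (- m)%ZZ = - ZC m.
Proof. by rewrite /ZC -mulrNz -[in RHS]rmorphN. Qed.
Lemma ZC_B m n : ZC (m - n)%ZZ = ZC m - ZC n.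
Proof. by rewrite -ZC_N -ZC_D. Qed.
Lemma ZC_conj m : Num.conj (ZC m) = ZC m.
Proof. by rewrite /ZC rmorph_int. Qed.
Lemma ZC_nat n : ZC (Z.of_nat n) = n%:R.
Proof. by rewrite /ZC -[Z.of_nat n]/(Z_of_int (Posz n)) Z_of_intK. Qed.

Lemma eisC_add x y : eisC (eis_add x y) = eisC x + eisC y.
Proof. by rewrite /eisC /= !ZC_D; ring. Qed.
Lemma eisC_mul x y : eisC (eis_mul x y) = eisC x * eisC y.
Proof.
rewrite /eisC /= !(ZC_D, ZC_M, ZC_N).
have -> : (ZC x.1 + ZC x.2 * omega) * (ZC y.1 + ZC y.2 * omega) =
  ZC x.1 * ZC y.1 + (ZC x.1 * ZC y.2 + ZC x.2 * ZC y.1) * omega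
   + ZC x.2 * ZC y.2 * (omega * omega) by ring.
by rewrite omega_sqr; ring.
Qed.
Lemma eisC_conj x : eisC (eis_conj x) = Num.conj (eisC x).
Proof.
rewrite /eisC /= rmorphD rmorphM /= !ZC_conj omega_conj !(ZC_D, ZC_N); ring.
Qed.
Lemma eisCZ n : eisC (eisZ n) = ZC n.
Proof. by rewrite /eisC /= [ZC 0]mulr0z mul0r addr0. Qed.
Lemma eisC0 : eisC eis0 = 0. Proof. by rewrite eisCZ /ZC mulr0z. Qed.
Lemma eisC_sum (T : Type) (s : seq T) (F : T -> eis) :
  eisC (eis_sum s F) = \sum_(x <- s) eisC (F x).
Proof.
elim: s => [|x s IH]; first by rewrite big_nil eisC0.
by rewrite big_cons -IH -eisC_add.
Qed.
Lemma eisC_sum_iota n (F : nat -> eis) :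
  eisC (eis_sum (iota 0 n) F) = \sum_(k < n) eisC (F k).
Proof.
by rewrite eisC_sum -(big_mkord xpredT (fun k => eisC (F k))) /index_iota subn0.
Qed.
Lemma eisC_eq x y : eis_eqb x y -> eisC x = eisC y.
Proof. by case: x y => [a b] [c d] /andP[/Z.eqb_spec /= -> /Z.eqb_spec /= ->]. Qed.

Lemma all_iota n (P : nat -> bool) : all P (iota 0 n) -> forall i : 'I_n, P i.
Proof. by move=> /allP h i; apply: h; rewrite mem_iota /=. Qed.

Definition ket (f : eis_vec) : 'cV[C]_3 := \col_i eisC (vcoef f i).

Lemma eisC_dot f g : eisC (eis_dot f g) = ((ket f)^t* *m ket g) 0 0.
Proof.
rewrite /eis_dot eisC_sum_iota mxE; apply: eq_bigr => k _.
by rewrite eisC_mul eisC_conj !mxE.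
Qed.

Definition sic_ket (phi : seq eis_vec) (a : 'I_(3 ^ 2)) : 'cV[C]_3 :=
  ((Num.sqrt 2%:R)^-1)%:C *: ket (nth [::] phi a).

Definition sic_effect (phi : seq eis_vec) (a : 'I_(3 ^ 2)) : 'M[C]_3 :=
  3%:R^-1 *: (sic_ket phi a *m (sic_ket phi a)^t*).

Lemma invsqrt2_sqr :
  (((Num.sqrt 2%:R)^-1)%:C : C) * ((Num.sqrt 2%:R)^-1)%:C = 2%:R^-1.
Proof.
rewrite -rmorphM /= -invfM -expr2 sqr_sqrtr ?ler0n //.
by rewrite fmorphV rmorph_nat.
Qed.

Lemma sic_ket_dot phi a b : ((sic_ket phi a)^t* *m sic_ket phi b) 0 0 =
  2%:R^-1 * eisC (eis_dot (nth [::] phi a) (nth [::] phi b)).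
Proof.
rewrite eisC_dot /sic_ket -scalemxAr trmxCZ -scalemxAl !mxE.
by rewrite conj_realC mulrA invsqrt2_sqr.
Qed.

Lemma sic_ket_outer phi a i j : (sic_ket phi a *m (sic_ket phi a)^t*) i j =
  2%:R^-1 * (eisC (vcoef (nth [::] phi a) i) *
    Num.conj (eisC (vcoef (nth [::] phi a) j))).
Proof.
rewrite !mxE big_ord1 !mxE rmorphM /= conj_realC mulrACA invsqrt2_sqr //.
Qed.

Lemma sic_ket_normalized phi a : sic_check phi ->
  ((sic_ket phi a)^t* *m sic_ket phi a) 0 0 = 1.
Proof.
move=> /andP[/andP[_ h] _]; rewrite sic_ket_dot.
have /eisC_eq -> := all_iota h a.
by rewrite eisCZ (ZC_nat 2) mulVf // pnatr_eq0.
Qed.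

Lemma sic_ket_overlap phi a b : sic_check phi -> a != b ->
  `|((sic_ket phi a)^t* *m sic_ket phi b) 0 0| ^+ 2 = 4%:R^-1.
Proof.
move=> /andP[/andP[h _] _] ab.
rewrite normCK sic_ket_dot rmorphM /= fmorphV rmorph_nat.
have /eisC_eq := all_iota (all_iota h a) b.
rewrite eisC_mul eisC_conj eisCZ (negbTE (ab : (a != b :> nat))) (ZC_nat 1) => e.
by rewrite mulrACA [X in _ * X]mulrC e; field.
Qed.

Lemma sic_povm_effects phi : size phi = 9 ->
  sic_check phi -> sic_povm (sic_effect phi).
Proof.
move=> sz h; split; last first.
  exists (sic_ket phi); split=> //.
  - by move=> a; apply: sic_ket_normalized.
  - by move=> a b; apply: sic_ket_overlap.
split=> [a|].
  have -> : sic_effect phi a =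
    ((Num.sqrt 3%:R)^-1%:C *: sic_ket phi a) *m ((Num.sqrt 3%:R)^-1%:C *: sic_ket phi a)^t*.
    rewrite trmxCZ -scalemxAl -scalemxAr scalerA conj_realC -rmorphM /=.
    by rewrite -invfM -expr2 sqr_sqrtr ?ler0n // fmorphV rmorph_nat.
  exact: psdmx_gram.
apply/matrixP => i j; rewrite summxE.
under eq_bigr do rewrite mxE sic_ket_outer mulrA.
rewrite -mulr_sumr.
have /andP[_ h3] := h; have /eisC_eq := all_iota (all_iota h3 i) j.
rewrite eisC_sum (big_nth [::]) sz big_mkord.
under eq_bigr do rewrite eisC_mul eisC_conj.
move=> ->; rewrite mxE; case: (eqVneq i j) => [->|ij].
  by rewrite eqxx eisCZ (ZC_nat 6) /=; field.
by rewrite (negbTE (ij : (i != j :> nat))) eisC0 mulr0.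
Qed.

Lemma ZC_eq0 n : (ZC n == 0) = (n == 0).
Proof.
rewrite /ZC intr_eq0; apply/eqP/eqP => [|-> //].
by rewrite -[0]/(int_of_Z 0) => /(can_inj int_of_ZK).
Qed.

Definition pm_effect (D : Z) (p : pm_code) (a : 'I_(3 ^ 2)) : 'M[C]_3 :=
  \matrix_(i, j) ((ZC D)^-1 * eisC (pm_entry p a i j)).

Lemma pm_effectP D p : D != 0 -> pm_check D p ->
  projective_measurement (pm_effect D p).
Proof.
rewrite -ZC_eq0 => D0 /and3P[_ h1 h2].
have proj a : orthogonal_projection (pm_effect D p a).
  have hh i j := andP (all_iota (all_iota (all_iota h1 a) i) j).
  split.
    apply/is_hermitianmxP; rewrite expr0 scale1r; apply/matrixP => i j.
    rewrite !mxE rmorphM fmorphV /= ZC_conj -eisC_conj.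
    by have [/eisC_eq -> _] := hh i j.
  apply/matrixP => i j; rewrite !mxE.
  under eq_bigr do rewrite !mxE mulrACA -eisC_mul.
  rewrite -mulr_sumr -(eisC_sum_iota 3 (fun k => eis_mul (pm_entry p a i k) (pm_entry p a k j))).
  have [_ /eisC_eq ->] := hh i j.
  by rewrite eisC_mul eisCZ mulrA divfK.
split=> //; split=> [a|]; first exact: orthogonal_projection_psd.
apply/matrixP => i j; rewrite summxE.
under eq_bigr do rewrite mxE.
rewrite -mulr_sumr -(eisC_sum_iota 9 (fun a => pm_entry p a i j)).
have /eisC_eq -> := all_iota (all_iota h2 i) j.
rewrite mxE; case: (eqVneq i j) => [->|ij].
  by rewrite eqxx eisCZ mulVf.
by rewrite (negbTE (ij : (i != j :> nat))) eisC0 mulr0.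
Qed.

Lemma ZC_real n : ZC n = ((int_of_Z n)%:~R : R)%:C.
Proof. by rewrite /ZC rmorph_int. Qed.

Lemma mxtrace_sic_effect phi (a : 'I_(3 ^ 2)) : sic_check phi ->
  \tr (sic_effect phi a) = 3%:R^-1.
Proof.
move=> h; rewrite mxtraceZ mxtrace_mulC /mxtrace big_ord1.
by rewrite sic_ket_normalized ?mulr1.
Qed.

Lemma sic_effectE phi a i j : sic_effect phi a i j =
  6%:R^-1 * (eisC (vcoef (nth [::] phi a) i) *
    Num.conj (eisC (vcoef (nth [::] phi a) j))).
Proof. by rewrite mxE sic_ket_outer mulrA -invfM -natrM. Qed.

(** [D W] times the depolarised effect has coefficient [D W v / 6] on the ket-bra of the integral
    vector and [D W (1 - v) / 9] on the identity. The last two equations identify these with [x] and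
    [y] for [v = m / n], cleared of denominators so that computation in [Z] decides them. *)
Lemma mixture_simulable D W x y m n phi ps :
  D != 0 -> W != 0 -> n != 0 -> sic_check phi -> all (pm_check D) ps ->
  mixture_check W x y phi ps ->
  (m * (D * W) = 6 * n * x)%ZZ -> ((n - m) * (D * W) = 9 * n * y)%ZZ ->
  projectively_simulable (fun a =>
    depolarise ((int_of_Z m)%:~R / (int_of_Z n)%:~R) (sic_effect phi a)).
Proof.
move=> D0 W0 n0 hs hp /andP[hW hm] ex ey.
set v := _ / _.
have vE : v%:C = ZC m / ZC n by rewrite rmorphM fmorphV /= !ZC_real.
have n0' : ZC n != 0 by rewrite ZC_eq0.
have hx : v%:C * ZC (D * W)%ZZ = 6%:R * ZC x.
  apply: (mulfI n0'); rewrite vE mulrA [ZC n * _]mulrC divfK // -ZC_M ex !ZC_M.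
  by rewrite (ZC_nat 6); ring.
have hy : (1 - v)%:C * ZC (D * W)%ZZ = 9%:R * ZC y.
  apply: (mulfI n0').
  have -> : ZC n * ((1 - v)%:C * ZC (D * W)%ZZ) = ZC ((n - m) * (D * W))%ZZ.
    rewrite rmorphB rmorph1 /= vE !ZC_M ZC_B mulrA mulrBr mulr1.
    by rewrite [ZC n * (_ / _)]mulrC divfK.
  by rewrite ey !ZC_M (ZC_nat 9); ring.
have DW0 : ZC (D * W)%ZZ != 0 by rewrite ZC_M mulf_neq0 ?ZC_eq0.
pose p0 : pm_code := (0%ZZ, [::]).
have pos k : Z.leb 0 k -> 0 <= ((int_of_Z k)%:~R : R).
  by case: k => // k _; rewrite ler0z.
have sumW : \sum_(p <- ps) ZC p.1 = ZC W.
  move/Z.eqb_spec: hW => <-; elim: (ps) => [|p s IH] /=; first by rewrite big_nil /ZC mulr0z.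
  by rewrite big_cons IH -ZC_D.
exists (size ps), (fun l => (int_of_Z (nth p0 ps l).1)%:~R / (int_of_Z W)%:~R),
  (fun l => pm_effect D (nth p0 ps l)); split.
- move=> l; have /allP/(_ (nth p0 ps l)) := hp.
  rewrite mem_nth // => /(_ isT)/andP[w0' _]; apply: mulr_ge0; first exact: pos.
  rewrite invr_ge0; apply: pos.
  move/Z.eqb_spec: hW => <-; elim: (ps) hp => [//|p s IH] /= /andP[/andP[/Z.leb_spec0 a1 _] a2].
  by apply/Z.leb_spec0; apply: Z.add_nonneg_nonneg => //; apply/Z.leb_spec0; apply: IH.
- apply: (@complexI R); rewrite rmorph_sum.
  under eq_bigr do rewrite rmorphM fmorphV /= -!ZC_real.
  rewrite -mulr_suml -(big_mkord xpredT (fun l => ZC (nth p0 ps l).1)).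
  by rewrite -(big_nth p0 xpredT (fun p => ZC p.1)) sumW mulfV // ZC_eq0.
- move=> l; apply: pm_effectP => //; move/allP: hp; apply; exact: mem_nth.
move=> a; apply/matrixP => i j; rewrite summxE.
have -> : \sum_(l < size ps) (((int_of_Z (nth p0 ps l).1)%:~R / (int_of_Z W)%:~R)%:C
     *: pm_effect D (nth p0 ps l) a) i j =
   (ZC (D * W)%ZZ)^-1 * \sum_(p <- ps) eisC (eis_mul (eisZ p.1) (pm_entry p a i j)).
  rewrite (big_nth p0) big_mkord mulr_sumr; apply: eq_bigr => l _.
  rewrite !mxE rmorphM fmorphV /= -!ZC_real eisC_mul eisCZ ZC_M invfM.
  by rewrite mulrACA mulrC mulrA [in RHS]mulrACA; ring.
have /eisC_eq := all_iota (all_iota (all_iota hm a) i) j.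
rewrite eisC_sum => ->; rewrite eisC_add !eisC_mul eisC_conj !eisCZ.
apply: (mulfI DW0); rewrite mulVKf //.
rewrite depolariseE mxtrace_sic_effect // sic_effectE.
set u := eisC _ * _.
have -> : ((1 - v) / 3%:R)%:C * 3%:R^-1 = (1 - v)%:C / 9%:R :> C.
  by rewrite rmorphM fmorphV /= rmorph_nat; field.
rewrite mulrDr; congr (_ + _).
  transitivity (6%:R^-1 * (v%:C * ZC (D * W)%ZZ) * u); last by rewrite hx mulKf // pnatr_eq0.
  have r (a1 b1 c1 d1 : C) : a1 * (b1 * (c1 * d1)) = c1 * (b1 * a1) * d1 by ring.
  exact: r.
transitivity (9%:R^-1 * ((1 - v)%:C * ZC (D * W)%ZZ) * (i == j)%:R); last first.
  rewrite hy mulKf ?pnatr_eq0 //; case: (eqVneq i j) => [->|ij].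
    by rewrite eqxx eisCZ mulr1.
  by rewrite (negbTE (ij : (i != j :> nat))) eisC0 mulr0.
have r (a1 b1 c1 d1 : C) : a1 * (b1 * c1 * d1) = c1 * (b1 * a1) * d1 by ring.
exact: r.
Qed.

Lemma sic1_simulable : projectively_simulable
  (fun a => depolarise (169%:R / 210%:R : R)
    (sic_effect (sic_vecs (eisZ 1)) a)).
Proof.
have -> : 169%:R / 210%:R =
    (int_of_Z (Z.of_nat 169))%:~R / (int_of_Z (Z.of_nat 210))%:~R :> R.
  by rewrite -![Z.of_nat _]/(Z_of_int (Posz _)) !Z_of_intK.
apply: (@mixture_simulable 2700%ZZ 1512%ZZ 547560%ZZ 88560%ZZ (Z.of_nat 169)
  (Z.of_nat 210) (sic_vecs (eisZ 1)) sic1_measurements).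
- by [].
- by [].
- by [].
- exact: sic_check1.
- exact: sic1_measurements_check.
- exact: sic1_mixture_check.
- by vm_compute.
- by vm_compute.
Qed.

Lemma sicN1_simulable : projectively_simulable
  (fun a => depolarise (0 : R) (sic_effect (sic_vecs (eisZ (-1))) a)).
Proof.
have -> : 0 = (int_of_Z 0)%:~R / (int_of_Z 1)%:~R :> R by rewrite mul0r.
apply: (@mixture_simulable 1 9 0 1 0 1 (sic_vecs (eisZ (-1))) trivial_measurements).
- by [].
- by [].
- by [].
- exact: sic_checkN1.
- exact: trivial_measurements_check.
- exact: trivial_mixture_check.
- by vm_compute.
- by vm_compute.
Qed.

Lemma phase_check_condition phi : phase_check phi ->
  phase_condition (sic_ket phi).
Proof.
move=> h a b c ab bc ca z.
pose t := eis_mul (eis_mul (eis_dot (nth [::] phi a) (nth [::] phi b))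
  (eis_dot (nth [::] phi b) (nth [::] phi c)))
  (eis_dot (nth [::] phi c) (nth [::] phi a)).
have -> : z + Num.conj z = 8%:R^-1 * eisC (eis_add t (eis_conj t)).
  have -> : z = 8%:R^-1 * eisC t.
    rewrite /z !sic_ket_dot /t !eisC_mul.
    move: (eisC _) (eisC _) (eisC _) => u v w.
    have -> : 8%:R^-1 = 2%:R^-1 * 2%:R^-1 * 2%:R^-1 :> C by field.
    by ring.
  by rewrite eisC_add eisC_conj rmorphM fmorphV /= rmorph_nat [RHS]mulrDr.
have := all_iota (all_iota (all_iota h a) b) c.
rewrite (negbTE (ab : a != b :> nat)) (negbTE (bc : b != c :> nat)).
rewrite (negbTE (ca : c != a :> nat)) /= -/t.
case/orP=> /eisC_eq ->; rewrite eisCZ; [left|right].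
  by rewrite (ZC_nat 1) mulr1.
by rewrite (ZC_N 2) (ZC_nat 2); field.
Qed.

Lemma sicN1_visibility (v : R) : projectively_simulable
  (fun a => depolarise v (sic_effect (sic_vecs (eisZ (-1))) a)) ->
  v <= 4%:R / 5%:R.
Proof.
apply: (visibility_bound (psi := sic_ket (sic_vecs (eisZ (-1))))).
- by move=> a; apply: sic_ket_normalized sic_checkN1.
- by move=> a b; apply: sic_ket_overlap sic_checkN1.
- by [].
exact: phase_check_condition phase_checkN1.
Qed.

End Transport.

(** * Comparison of the two thresholds *)

Theorem mainTheorem2 (R : realType) :
  exists E E' : 'I_(3 ^ 2)%N -> 'M[R[i]]_3,
    [/\ sic_povm E, sic_povm E' &
        exists v v' : R,
          [/\ is_simulability_threshold E v,
              is_simulability_threshold E' v' & v <> v']].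
Proof.
pose E := sic_effect R (sic_vecs (eisZ (-1))).
pose E' := sic_effect R (sic_vecs (eisZ 1)).
have [v hv] : exists v, is_simulability_threshold E v.
  apply: threshold_exists; exists 0; split; last exact: sicN1_simulable.
  by rewrite lexx ler01.
have S' : simulable_visibilities E' (169%:R / 210%:R).
  split; last exact: sic1_simulable.
  by apply/andP; split; lra.
have [v' hv'] : exists v', is_simulability_threshold E' v'.
  by apply: threshold_exists; exists (169%:R / 210%:R).
exists E, E'; split; [|by apply: sic_povm_effects sic_check1|exists v, v'; split=> //].
  exact: sic_povm_effects sic_checkN1.
(* The bound 4/5 is 168/210, so the thresholds differ by at least 1/210. *)
have le : v <= 4%:R / 5%:R by apply: sicN1_visibility; case: hv => [[]].
have ge : 169%:R / 210%:R <= v' by case: hv' => _; apply.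
by move=> e; rewrite -e in ge; lra.
Qed.
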